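(* Let $\mathcal{V}$ be a semidegenerate congruence-modular variety and let $A\in\mathcal{V}$. The following are equivalent: (1) $A$ is a spectral algebra; (2) $A$ is a quasi-commutative algebra; (3) for every ideal $I$ of the lattice $L(A)$ we have $I=(I_{\ast})^{\ast}$.
   Context: Algebras have a fixed finite signature $\tau$. A variety is semidegenerate if none of its nontrivial algebras has a one-element subalgebra. For $A$ in a semidegenerate congruence-modular variety $\mathcal{V}$, $Con(A)$ is the congruence lattice with least element $\Delta_A$ and greatest element $\nabla_A$; $K(A)$ is the set of compact (= finitely generated) congruences (here $\nabla_A\in K(A)$); $PCon(A)$ is the set of principal congruences. $[\cdot,\cdot]$ is the modular commutator of Freese–McKenzie: the greatest operation on congruence lattices of members of $\mathcal{V}$ such that for every surjective morphism $f:A\to B$ and $\alpha,\beta\in Con(A)$, $[\alpha,\beta]_A\subseteq\alpha\cap\beta$ and $[\alpha,\beta]_A\lor Ker(f)=f^{-1}([f(\alpha\lor Ker(f)),f(\beta\lor Ker(f))]_B)$. It is commutative, monotone, distributes over arbitrary joins, and satisfies $[\theta,\nabla_A]=\theta$. A congruence $\phi\neq\nabla_A$ is prime if $[\alpha,\beta]\subseteq\phi$ implies $\alpha\subseteq\phi$ or $\beta\subseteq\phi$, for all $\alpha,\beta\in Con(A)$. $Spec(A)$ is the set of prime congruences; $D(\theta)=\{\phi\in Spec(A)\mid\theta\not\subseteq\phi\}$; $Spec_Z(A)$ is $Spec(A)$ with the topology whose open sets are the $D(\theta)$, $\theta\in Con(A)$. The radical is $\rho(\theta)=\bigwedge\{\phi\in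 Spec(A)\mid\theta\subseteq\phi\}$. $C(A)$ is the smallest subset of $Con(A)$ containing $K(A)$ and closed under binary joins and commutators. For $\alpha,\beta\in C(A)$ put $\alpha\equiv\beta$ iff $\rho(\alpha)=\rho(\beta)$. $L(A)=C(A)/{\equiv}$ is a bounded distributive lattice with join induced by $\lor$, meet induced by $[\cdot,\cdot]$, $0$ = class of $\Delta_A$, $1$ = class of $\nabla_A$; $\lambda_A:C(A)\to L(A)$ is the quotient map. For $\theta\in Con(A)$, $\theta^{\ast}=\{\lambda_A(\alpha)\mid\alpha\in C(A),\alpha\subseteq\theta\}$ (an ideal of $L(A)$); for an ideal $I$ of $L(A)$, $I_{\ast}=\bigvee\{\alpha\in K(A)\mid\lambda_A(\alpha)\in I\}\in Con(A)$. $A$ is quasi-commutative if for all $\alpha,\beta\in PCon(A)$ there is $\gamma\in K(A)$ with $\gamma\subseteq[\alpha,\beta]$ and $\rho(\gamma)=\rho([\alpha,\beta])$. A topological space is spectral if it is compact (every open cover has a finite subcover) and $T_0$, its compact open subsets form a basis closed under finite intersections, and every irreducible closed subset has a generic point. $A$ is a spectral algebra if $Spec_Z(A)$ is a spectral space and $D(\alpha)$ is a compact subset of $Spec_Z(A)$ for every $\alpha\in K(A)$. *)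

(* Defs.v *)
From HB Require Import structures.
From mathcomp Require Import all_boot all_order generic_quotient.
From mathcomp Require Import boolp classical_sets cardinality topology.

Set Implicit Arguments.
Unset Strict Implicit.
Unset Printing Implicit Defensive.

Import Order.TTheory.
Local Open Scope classical_set_scope.
Local Open Scope quotient_scope.
Local Open Scope order_scope.

Record signature := Signature { symbol : finType; arity : symbol -> nat }.
Arguments arity {s}.

Record algebra (tau : signature) := Algebra {
  carrier :> Type;
  op : forall f : symbol tau, ('I_(arity f) -> carrier) -> carrier;
  carrier_inhabited : inhabited carrier }.
Arguments op {tau} a f.

Inductive term (tau : signature) :=
| Var of nat
| App (f : symbol tau) of ('I_(arity f) -> term tau).

Fixpoint eval (tau : signature) (A : algebra tau) (v : nat -> A)
    (t : term tau) : A :=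
  match t with
  | Var n => v n
  | App f ts => op A f (fun i => eval v (ts i))
  end.

(* A variety is presented as the equational class of a set of identities. *)
Record variety (tau : signature) :=
  Variety { identities : set (term tau * term tau) }.

Definition satisfies (tau : signature) (A : algebra tau)
    (e : term tau * term tau) : Prop :=
  forall v : nat -> A, eval v e.1 = eval v e.2.

Record member (tau : signature) (V : variety tau) := Member {
  member_algebra :> algebra tau;
  memberP : forall e, identities V e -> satisfies member_algebra e }.

Record hom (tau : signature) (A B : algebra tau) := Hom {
  hom_fun :> A -> B;
  hom_op : forall f (args : 'I_(arity f) -> A),
    hom_fun (op A f args) = op B f (fun i => hom_fun (args i)) }.

Definition surjective_hom (tau : signature) (A B : algebra tau)
  (h : hom A B) : Prop := forall y, exists x, h x = y.

Definition subalgebra (tau : signature) (A : algebra tau) (S : set A) : Prop :=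
  forall f (args : 'I_(arity f) -> A),
    (forall i, S (args i)) -> S (op A f args).

Definition nontrivial (tau : signature) (A : algebra tau) : Prop :=
  exists x y : A, x <> y.

Definition semidegenerate (tau : signature) (V : variety tau) : Prop :=
  forall A : member V, nontrivial A -> ~ exists a : A, subalgebra [set a].

Record congruence (tau : signature) (A : algebra tau) := Congruence {
  crel :> A -> A -> Prop;
  crel_refl : forall x, crel x x;
  crel_sym : forall x y, crel x y -> crel y x;
  crel_trans : forall x y z, crel x y -> crel y z -> crel x z;
  crel_op : forall f (a b : 'I_(arity f) -> A),
    (forall i, crel (a i) (b i)) -> crel (op A f a) (op A f b) }.

HB.instance Definition _ (tau : signature) (A : algebra tau) :=
  gen_eqMixin (congruence A).
HB.instance Definition _ (tau : signature) (A : algebra tau) :=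
  gen_choiceMixin (congruence A).

Section CongruenceLattice.
Context {tau : signature} {A : algebra tau}.
Implicit Types (alpha beta theta : congruence A) (S : set (congruence A)).

Lemma congruence_ext alpha beta :
  (forall x y, alpha x y <-> beta x y) -> alpha = beta.
Proof.
case: alpha beta => [r r1 r2 r3 r4] [s s1 s2 s3 s4] /= rs.
have E : r = s by apply/funext => x; apply/funext => y; apply/propext.
by subst s; congr Congruence; apply: Prop_irrelevance.
Qed.

Definition cle : rel (congruence A) :=
  fun alpha beta => `[< forall x y, alpha x y -> beta x y >].

Fact cle_refl : reflexive cle. Proof. by move=> alpha; apply/asboolP. Qed.

Fact cle_anti : antisymmetric cle.
Proof.
move=> alpha beta /andP[/asboolP ab /asboolP ba].
by apply: congruence_ext => x y; split; [apply: ab | apply: ba].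
Qed.

Fact cle_trans : transitive cle.
Proof.
move=> beta alpha theta /asboolP ab /asboolP bt.
by apply/asboolP => x y /ab /bt.
Qed.

Fact congruence_display : Order.disp_t. Proof. exact: Order.Disp tt tt. Qed.

HB.instance Definition _ := Order.Le_isPOrder.Build congruence_display
  (congruence A) cle_refl cle_anti cle_trans.

Lemma cleP alpha beta :
  reflect (forall x y, alpha x y -> beta x y) (alpha <= beta).
Proof. exact: asboolP. Qed.

Program Definition cinf S : congruence A :=
  @Congruence tau A (fun x y => forall theta, S theta -> theta x y) _ _ _ _.
Next Obligation. by move=> S x theta _; apply: crel_refl. Qed.
Next Obligation. by move=> S x y xy t /xy; apply: crel_sym. Qed.
Next Obligation.
by move=> S x y z xy yz t St; apply: crel_trans (xy _ St) (yz _ St).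
Qed.
Next Obligation.
by move=> S f a b ab t St; apply: crel_op => i; apply: ab.
Qed.

Definition csup S : congruence A := cinf (ubound S).

Definition cgen (X : set (A * A)) : congruence A :=
  cinf [set theta | forall p, X p -> theta p.1 p.2].

Lemma cinf_lb S theta : S theta -> cinf S <= theta.
Proof. by move=> St; apply/cleP => x y; apply. Qed.

Lemma le_cinf S theta :
  (forall alpha, S alpha -> theta <= alpha) -> theta <= cinf S.
Proof. by move=> h; apply/cleP => x y xy alpha /h/cleP; apply. Qed.

Lemma csup_ub S theta : S theta -> theta <= csup S.
Proof. by move=> St; apply: le_cinf => alpha; apply. Qed.

Lemma csup_le S theta :
  (forall alpha, S alpha -> alpha <= theta) -> csup S <= theta.
Proof. exact: cinf_lb. Qed.

Program Definition cmeet alpha beta : congruence A :=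
  @Congruence tau A (fun x y => alpha x y /\ beta x y) _ _ _ _.
Next Obligation. by move=> a b x; split; apply: crel_refl. Qed.
Next Obligation. by move=> a b x y []; split; apply: crel_sym. Qed.
Next Obligation.
move=> a b x y z [axy bxy] [ayz byz].
by split; [apply: crel_trans axy ayz | apply: crel_trans bxy byz].
Qed.
Next Obligation.
by move=> al be f a b ab; split; apply: crel_op => i; case: (ab i).
Qed.

Definition cjoin alpha beta : congruence A := csup [set alpha; beta].

Program Definition cbot : congruence A := @Congruence tau A eq _ _ _ _.
Next Obligation. by []. Qed.
Next Obligation. by []. Qed.
Next Obligation. by move=> x y z ->. Qed.
Next Obligation. by move=> f a b ab; congr op; apply/funext. Qed.

Definition ctop : congruence A := @Congruence tau A (fun _ _ => True)
  (fun _ => I) (fun _ _ _ => I) (fun _ _ _ _ _ => I) (fun _ _ _ _ => I).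

Fact le_cmeet theta alpha beta :
  (theta <= cmeet alpha beta) = (theta <= alpha) && (theta <= beta).
Proof.
apply/cleP/andP => [h|[/cleP ta /cleP tb] x y xy].
  by split; apply/cleP => x y /h[].
by split; [apply: ta | apply: tb].
Qed.

Fact cjoin_le alpha beta theta :
  (cjoin alpha beta <= theta) = (alpha <= theta) && (beta <= theta).
Proof.
apply/idP/andP => [h|[at_ bt]].
  by split; apply: le_trans h; apply: csup_ub; [left | right].
by apply: csup_le => _ [] ->.
Qed.

Fact cbot_le theta : cbot <= theta.
Proof. by apply/cleP => x _ <-; apply: crel_refl. Qed.

Fact le_ctop theta : theta <= ctop. Proof. exact/cleP. Qed.

HB.instance Definition _ := Order.POrder_isMeetSemilattice.Build
  congruence_display (congruence A) le_cmeet.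
HB.instance Definition _ := Order.POrder_isJoinSemilattice.Build
  congruence_display (congruence A) cjoin_le.
HB.instance Definition _ := Order.hasBottom.Build
  congruence_display (congruence A) cbot_le.
HB.instance Definition _ := Order.hasTop.Build
  congruence_display (congruence A) le_ctop.

(* The finitely generated congruences are the compact elements of the
   congruence lattice. *)
Definition finitely_generated : set (congruence A) :=
  [set theta | exists2 X : set (A * A), finite_set X & theta = cgen X].

Definition principal : set (congruence A) :=
  [set theta | exists a b : A, theta = cgen [set (a, b)]].

End CongruenceLattice.

Definition congruence_modular (tau : signature) (V : variety tau) : Prop :=
  forall (A : member V) (alpha beta gamma : congruence A), alpha <= gamma ->
    alpha `|` (beta `&` gamma) = (alpha `|` beta) `&` gamma.

Section Homomorphisms.
Context {tau : signature} {A B : algebra tau} (h : hom A B).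

Program Definition cpreim (theta : congruence B) : congruence A :=
  @Congruence tau A (fun x y => theta (h x) (h y)) _ _ _ _.
Next Obligation. by move=> t x; apply: crel_refl. Qed.
Next Obligation. by move=> t x y; apply: crel_sym. Qed.
Next Obligation. by move=> t x y z; apply: crel_trans. Qed.
Next Obligation. by move=> t f a b ab /=; rewrite !hom_op; apply: crel_op. Qed.

Definition cker : congruence A := cpreim \bot.

(* The congruence generated by the image of theta; it is the image itself when
   h is surjective and theta contains the kernel of h (lemma cimageE). *)
Definition cimage (theta : congruence A) : congruence B :=
  cgen [set p | exists x y, theta x y /\ p = (h x, h y)].

Lemma cimageE (theta : congruence A) u v :
  surjective_hom h -> cker <= theta ->
  cimage theta u v <-> exists x y, [/\ theta x y, u = h x & v = h y].
Proof.
move=> hs /cleP kt; split=> [|[x [y [xy -> ->]]]]; last first.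
  by move=> g /= /(_ (h x, h y)); apply; exists x, y.
pose r (u v : B) := exists x y, [/\ theta x y, u = h x & v = h y].
have rE x y : r (h x) (h y) -> theta x y.
  move=> [x' [y' [xy' ex ey]]]; apply: crel_trans (kt x x' ex) _.
  by apply: crel_trans xy' _; apply: kt.
have r1 x : r x x.
  by have [a <-] := hs x; exists a, a; split=> //; apply: crel_refl.
have r2 x y : r x y -> r y x.
  by move=> [a [b [ab -> ->]]]; exists b, a; split=> //; apply: crel_sym.
have r3 x y z : r x y -> r y z -> r x z.
  have [a <-] := hs x; have [b <-] := hs y; have [c <-] := hs z.
  move=> /rE ab /rE bc; exists a, c; split=> //; exact: crel_trans bc.
have r4 f (a b : 'I_(arity f) -> B) :
    (forall i, r (a i) (b i)) -> r (op B f a) (op B f b).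
  move=> /choice[x /choice[y xy]]; exists (op A f x), (op A f y).
  split; first by apply: crel_op => i; case: (xy i).
    by rewrite hom_op; congr op; apply/funext => i; case: (xy i).
  by rewrite hom_op; congr op; apply/funext => i; case: (xy i).
move=> /(_ (Congruence r1 r2 r3 r4)); apply => _ [x [y [xy ->]]] /=.
by exists x, y.
Qed.

End Homomorphisms.

Section Commutator.
Context {tau : signature} (V : variety tau).

Definition commutator_operation
    (C : forall A : member V, congruence A -> congruence A -> congruence A) :
    Prop :=
  forall (A B : member V) (h : hom A B), surjective_hom h ->
  forall alpha beta : congruence A,
    C A alpha beta <= alpha `&` beta /\
    C A alpha beta `|` cker h =
      cpreim h (C B (cimage h (alpha `|` cker h))
                    (cimage h (beta `|` cker h))).

(* The pointwise supremum of all such operations is itself such an operation,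
   hence the greatest one (lemma commutator_greatest). *)
Definition commutator (A : member V) (alpha beta : congruence A) :
    congruence A :=
  csup [set C A alpha beta | C in commutator_operation].

Lemma commutator_le (A : member V) (alpha beta : congruence A) :
  commutator alpha beta <= alpha `&` beta.
Proof.
apply: csup_le => _ [C CC <-].
have idP : forall f (args : 'I_(arity f) -> A),
  (fun x : A => x) (op A f args) = op A f (fun i => args i) by [].
by have [] := CC A A (Hom idP) (fun y => ex_intro _ y erefl) alpha beta.
Qed.

Lemma commutator_greatest :
  commutator_operation commutator /\
  forall C, commutator_operation C ->
    forall (A : member V) (alpha beta : congruence A),
      C A alpha beta <= commutator alpha beta.
Proof.
split; last first.
  by move=> C CC A alpha beta; apply: csup_ub; exists C.
move=> A B h hs alpha beta; split; first exact: commutator_le.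
set a' := cimage h _; set b' := cimage h _.
apply/le_anti/andP; split.
  rewrite leUx; apply/andP; split.
    apply: csup_le => _ [C CC <-].
    apply: (@le_trans _ _ (C A alpha beta `|` cker h)); first exact: leUl.
    have [_ ->] := CC _ _ _ hs alpha beta.
    have /cleP le : C B a' b' <= commutator a' b'.
      by apply: csup_ub; exists C.
    by apply/cleP => x y /le.
  by apply/cleP => x y /= e theta _; rewrite e; apply: crel_refl.
set g := _ `|` _.
have kg : cker h <= g by exact: leUr.
have /cleP le : commutator a' b' <= cimage h g.
  apply: csup_le => _ [C CC <-]; apply/cleP => u v.
  have [x <-] := hs u; have [y <-] := hs v => xy.
  apply/cimageE => //; exists x, y; split=> //.
  have [_ E] := CC _ _ _ hs alpha beta.
  have : (C A alpha beta `|` cker h) x y by rewrite E.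
  apply/cleP; rewrite /g leU2 //; apply: csup_ub; by exists C.
apply/cleP => x y /le /(cimageE _ _ hs kg)[x' [y' [xy' ex ey]]].
move/cleP: kg => kg; apply: crel_trans (kg x x' ex) _.
by apply: crel_trans xy' _; apply: kg.
Qed.

End Commutator.

Section Spectrum.
Context {tau : signature} {V : variety tau} (A : member V).
Implicit Types (alpha beta theta : congruence A).

Definition prime_congruence : set (congruence A) :=
  [set phi | phi <> \top /\ forall alpha beta,
     commutator alpha beta <= phi -> alpha <= phi \/ beta <= phi].

Definition spec := set_type prime_congruence.
HB.instance Definition _ := Choice.on spec.

Definition spec_open theta : set spec := [set phi | ~ theta <= val phi].

Definition radical theta : congruence A :=
  cinf [set phi | prime_congruence phi /\ theta <= phi].

Lemma prime_commutator phi alpha beta : prime_congruence phi ->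
  commutator alpha beta <= phi <-> alpha <= phi \/ beta <= phi.
Proof.
move=> [_ pP]; split; first exact: pP.
have := commutator_le alpha beta; rewrite lexI => /andP[ca cb].
by case; apply: le_trans.
Qed.

Fact spec_openT : range spec_open setT.
Proof.
exists \top => //; apply/seteqP; split=> // phi _ /=.
have [+ _] := set_mem (valP phi); apply: contra_not.
by rewrite le1x => /eqP.
Qed.

Fact spec_openI : setI_closed (range spec_open).
Proof.
move=> _ _ [alpha _ <-] [beta _ <-]; exists (commutator alpha beta) => //.
apply/seteqP; split=> phi /=;
  rewrite /spec_open /= (prime_commutator _ _ (set_mem (valP phi))).
- by move=> /not_orP.
- by move=> ?; apply/not_orP.
Qed.

Fact spec_open_bigU (I : Type) (f : I -> set spec) :
  (forall i, range spec_open (f i)) -> range spec_open (\bigcup_i f i).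
Proof.
move=> fo; have /choice[t tE] i : exists theta, spec_open theta = f i.
  by have [theta _ E] := fo i; exists theta.
exists (csup (range t)) => //; apply/seteqP; split=> phi /=.
  move=> /= nle; apply: contrapT => nU; apply: nle.
  apply: csup_le => _ [i _ <-]; apply: contrapT => nle.
  by apply: nU; exists i => //; rewrite -tE.
case=> i _; rewrite -tE => nle le; apply: nle.
by apply: le_trans le; apply: csup_ub; exists i.
Qed.

HB.instance Definition _ :=
  isOpenTopological.Build spec spec_openT spec_openI spec_open_bigU.

Lemma open_specE : @open spec = range spec_open.
Proof. by []. Qed.

End Spectrum.

Section Reticulation.
Context {tau : signature} {V : variety tau} (A : member V).
Implicit Types (alpha beta theta : congruence A).

Definition commutator_closure : set (congruence A) :=
  smallest [set X | forall alpha beta, X alpha -> X beta ->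
                      X (alpha `|` beta) /\ X (commutator alpha beta)]
    finitely_generated.

Fact commutator_closureU alpha beta :
  commutator_closure alpha -> commutator_closure beta ->
  commutator_closure (alpha `|` beta).
Proof. by move=> Ca Cb X XP; apply: (XP.1 _ _ (Ca X XP) (Cb X XP)).1. Qed.

Fact commutator_closureC alpha beta :
  commutator_closure alpha -> commutator_closure beta ->
  commutator_closure (commutator alpha beta).
Proof. by move=> Ca Cb X XP; apply: (XP.1 _ _ (Ca X XP) (Cb X XP)).2. Qed.

Fact commutator_closure0 : commutator_closure \bot.
Proof.
apply: sub_gen_smallest; exists set0; first exact: finite_set0.
by apply/le_anti; rewrite le0x /=; apply: cinf_lb.
Qed.

Definition ccl := set_type commutator_closure.
HB.instance Definition _ := Choice.on ccl.

Definition ccl_join (a b : ccl) : ccl :=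
  SigSub (mem_set (commutator_closureU (set_mem (valP a)) (set_mem (valP b)))).
Definition ccl_comm (a b : ccl) : ccl :=
  SigSub (mem_set (commutator_closureC (set_mem (valP a)) (set_mem (valP b)))).
Definition ccl_bot : ccl := SigSub (mem_set commutator_closure0).

Definition ccl_equiv : rel ccl :=
  fun a b => radical (val a) == radical (val b).

Fact ccl_equiv_refl : reflexive ccl_equiv. Proof. by move=> a; apply/eqP. Qed.
Fact ccl_equiv_sym : symmetric ccl_equiv.
Proof. by move=> a b; apply: eq_sym. Qed.
Fact ccl_equiv_trans : transitive ccl_equiv.
Proof. by move=> b a c /eqP ab /eqP bc; apply/eqP; rewrite ab. Qed.

Canonical ccl_equiv_rel :=
  EquivRel ccl_equiv ccl_equiv_refl ccl_equiv_sym ccl_equiv_trans.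

Definition reticulation := {eq_quot ccl_equiv}.
HB.instance Definition _ := Choice.on reticulation.
HB.instance Definition _ := EqQuotient.on reticulation.

Definition lam (a : ccl) : reticulation := \pi a.

Lemma radical_le alpha phi : prime_congruence phi ->
  (radical alpha <= phi) = (alpha <= phi).
Proof.
move=> pp; apply/idP/idP => h; last exact: cinf_lb.
by apply: le_trans h; apply: le_cinf => ? [].
Qed.

Lemma radicalP alpha beta : radical alpha = radical beta <->
  forall phi, prime_congruence phi -> (alpha <= phi <-> beta <= phi).
Proof.
split=> [E phi pp|h].
  by rewrite -(radical_le alpha pp) -(radical_le beta pp) E.
congr cinf; apply/seteqP; split=> phi [pp /(h _ pp)]; by split.
Qed.

Lemma lamP (a b : ccl) : lam a = lam b <->
  forall phi, prime_congruence phi -> (val a <= phi <-> val b <= phi).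
Proof.
rewrite -radicalP; split=> [/eqquotP/eqP //|E].
by apply/eqquotP/eqP.
Qed.

Definition ret_meet (x y : reticulation) : reticulation :=
  lam (ccl_comm (repr x) (repr y)).
Definition ret_join (x y : reticulation) : reticulation :=
  lam (ccl_join (repr x) (repr y)).
Definition ret_bot : reticulation := lam ccl_bot.

Lemma lam_repr x : lam (repr x) = x. Proof. exact: reprK. Qed.

Lemma ret_eqP (a b : ccl) :
  (forall phi, prime_congruence phi -> (val a <= phi) = (val b <= phi)) ->
  lam a = lam b.
Proof. by move=> h; apply/lamP => phi /h ->. Qed.

Lemma ccl_commE (a b : ccl) phi : prime_congruence phi ->
  (val (ccl_comm a b) <= phi) = (val a <= phi) || (val b <= phi).
Proof.
move=> pp; apply/idP/orP; first by move/(prime_commutator _ _ pp).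
by move=> h; apply/(prime_commutator _ _ pp).
Qed.

Lemma ccl_joinE (a b : ccl) phi :
  (val (ccl_join a b) <= phi) = (val a <= phi) && (val b <= phi).
Proof. exact: leUx. Qed.

Lemma repr_lam_le (a : ccl) phi : prime_congruence phi ->
  (val (repr (lam a)) <= phi) = (val a <= phi).
Proof.
by move=> pp; apply/idP/idP; have /lamP/(_ _ pp)[] := lam_repr (lam a).
Qed.

Lemma ret_meetE (a b : ccl) : ret_meet (lam a) (lam b) = lam (ccl_comm a b).
Proof.
by apply: ret_eqP => phi pp; rewrite !ccl_commE // !repr_lam_le.
Qed.

Lemma ret_joinE (a b : ccl) : ret_join (lam a) (lam b) = lam (ccl_join a b).
Proof.
by apply: ret_eqP => phi pp; rewrite !ccl_joinE !repr_lam_le.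
Qed.

Let retE := (ret_meetE, ret_joinE).

Fact ret_meetC : commutative ret_meet.
Proof.
move=> x y; rewrite -[x]lam_repr -[y]lam_repr !retE.
by apply: ret_eqP => phi pp; rewrite !ccl_commE // orbC.
Qed.
Fact ret_joinC : commutative ret_join.
Proof.
move=> x y; rewrite -[x]lam_repr -[y]lam_repr !retE.
by apply: ret_eqP => phi pp; rewrite !ccl_joinE andbC.
Qed.
Fact ret_meetA : associative ret_meet.
Proof.
move=> x y z; rewrite -[x]lam_repr -[y]lam_repr -[z]lam_repr !retE.
by apply: ret_eqP => phi pp; rewrite !ccl_commE // orbA.
Qed.
Fact ret_joinA : associative ret_join.
Proof.
move=> x y z; rewrite -[x]lam_repr -[y]lam_repr -[z]lam_repr !retE.
by apply: ret_eqP => phi pp; rewrite !ccl_joinE andbA.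
Qed.
Fact ret_joinKI y x : ret_meet x (ret_join x y) = x.
Proof.
rewrite -[x]lam_repr -[y]lam_repr !retE.
by apply: ret_eqP => phi pp; rewrite ccl_commE // ccl_joinE; case: (_ <= _).
Qed.
Fact ret_meetKU y x : ret_join x (ret_meet x y) = x.
Proof.
rewrite -[x]lam_repr -[y]lam_repr !retE.
by apply: ret_eqP => phi pp; rewrite ccl_joinE ccl_commE //; case: (_ <= _).
Qed.
Fact ret_meetUl : left_distributive ret_meet ret_join.
Proof.
move=> x y z; rewrite -[x]lam_repr -[y]lam_repr -[z]lam_repr !retE.
apply: ret_eqP => phi pp.
by rewrite ccl_commE // !ccl_joinE !ccl_commE // orb_andl.
Qed.
Fact ret_meetxx : idempotent_op ret_meet.
Proof.
move=> x; rewrite -[x]lam_repr !retE.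
by apply: ret_eqP => phi pp; rewrite ccl_commE // orbb.
Qed.

Definition ret_le : rel reticulation := fun x y => ret_meet x y == x.
Definition ret_lt : rel reticulation := fun x y => (y != x) && ret_le x y.

Fact reticulation_display : Order.disp_t. Proof. exact: Order.Disp tt tt. Qed.

HB.instance Definition _ := Order.isMeetJoinDistrLattice.Build
  reticulation_display reticulation
  (fun x y => erefl : ret_le x y = (ret_meet x y == x))
  (fun x y => erefl : ret_lt x y = (y != x) && ret_le x y)
  ret_meetC ret_joinC ret_meetA ret_joinA ret_joinKI ret_meetKU ret_meetUl
  ret_meetxx.

(* Ideals only need the bottom element. The class of \top is a top element
   whenever \top is finitely generated, as in a semidegenerate variety. *)
Fact ret_bot_le (x : reticulation) : ret_bot <= x.
Proof.
apply/eqP; rewrite -[x]lam_repr; apply: etrans (ret_meetE _ _) _.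
by apply: ret_eqP => phi pp; rewrite ccl_commE //= le0x.
Qed.

HB.instance Definition _ := Order.hasBottom.Build
  reticulation_display reticulation ret_bot_le.

Definition star theta : set reticulation :=
  [set lam a | a in [set a : ccl | val a <= theta]].

Definition costar (I : set reticulation) : congruence A :=
  csup [set val a | a in [set a : ccl |
                          finitely_generated (val a) /\ I (lam a)]].

End Reticulation.

Definition lattice_ideal (d : Order.disp_t) (L : bDistrLatticeType d)
    (I : set L) : Prop :=
  [/\ I \bot,
      forall x y, I x -> I y -> I (x `|` y) &
      forall x y, x <= y -> I y -> I x].

Definition quasi_commutative (tau : signature) (V : variety tau)
    (A : member V) : Prop :=
  forall alpha beta : congruence A, principal alpha -> principal beta ->
    exists gamma : congruence A, [/\ finitely_generated gamma,
      gamma <= commutator alpha beta &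
      radical gamma = radical (commutator alpha beta)].

Definition irreducible_set (T : topologicalType) (F : set T) : Prop :=
  F !=set0 /\ forall F1 F2 : set T, closed F1 -> closed F2 ->
    F = (F1 `|` F2)%classic -> F = F1 \/ F = F2.

Definition compact_open (T : topologicalType) : set (set T) :=
  [set U | open U /\ cover_compact U].

Definition spectral_space (T : topologicalType) : Prop :=
  [/\ cover_compact [set: T],
      @kolmogorov_space T,
      basis (@compact_open T),
      setI_closed (@compact_open T) &
      forall F : set T, closed F -> irreducible_set F ->
        exists x, F = closure [set x]].

Definition spectral_algebra (tau : signature) (V : variety tau)
    (A : member V) : Prop :=
  spectral_space (spec A) /\
  forall alpha : congruence A, finitely_generated alpha ->
    cover_compact (spec_open alpha).

(* Main.v *)
(* Two properties of the commutator suffice. It is monotone: the join of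
   [C a b] over [a <= alpha], [b <= beta] is again a commutator operation, by
   the modular law, so it lies below the greatest one. And comparing with
   A / phi gives [phi | a, phi | b] <= phi | [a, b], which is what makes the
   maximal congruences produced by Zorn's lemma prime. Quasi-commutativity says
   that [alpha, beta] is equivalent to a finitely generated congruence below
   it; this passes to all of C(A), and by prime separation it makes
   [D alpha] compact for finitely generated [alpha]. Conversely, a compact
   [D theta] is covered by finitely many [D gamma] with [gamma <= theta]
   finitely generated, and their join witnesses quasi-commutativity. *)
Require Import Defs.
From mathcomp Require Import all_boot all_order finmap.
From mathcomp Require Import boolp classical_sets cardinality topology.

Set Implicit Arguments.
Unset Strict Implicit.
Unset Printing Implicit Defensive.

Import Order.TTheory.
Local Open Scope classical_set_scope.
Local Open Scope order_scope.

(** * Identities in homomorphic images *)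

Lemma eval_hom (tau : signature) (A B : algebra tau) (h : hom A B)
    (v : nat -> A) (t : term tau) :
  Defs.eval (h \o v) t = h (Defs.eval v t).
Proof.
elim: t => [//|f ts IH] /=; rewrite hom_op; congr op.
by apply/funext => i; apply: IH.
Qed.

(** By choice, a valuation in [B] lifts through [h] to one in [A]. *)
Lemma satisfies_surj (tau : signature) (A B : algebra tau) (h : hom A B) e :
  surjective_hom h -> satisfies A e -> satisfies B e.
Proof.
move=> hs sA v; have [w wE] := choice (fun n => hs (v n)).
by have -> : v = h \o w; [apply/funext => n /= | rewrite !eval_hom sA].
Qed.

(** * Quotient algebras *)

Section Quotient.
Context {tau : signature} {V : variety tau} {A : member V}.
Variable theta : congruence A.

Definition quot_repr (a : A) : A :=
  sval (cid (ex_intro (theta a) a (crel_refl theta a))).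

Lemma quot_repr_crel a : theta a (quot_repr a).
Proof. by rewrite /quot_repr; case: cid. Qed.

Lemma quot_reprE a b : quot_repr a = quot_repr b <-> theta a b.
Proof.
split=> [E|ab].
  apply: crel_trans (quot_repr_crel a) _; rewrite E.
  exact/crel_sym/quot_repr_crel.
have E : theta a = theta b.
  apply/funext => c; apply/propext; split=> h; last exact: crel_trans h.
  by apply: crel_trans h; apply: crel_sym.
(* The element chosen by [cid] depends on the predicate alone, so related elements, having equal
   classes, share a representative. *)
have cidE (P Q : A -> Prop) (p : exists x, P x) (q : exists x, Q x) :
  P = Q -> sval (cid p) = sval (cid q).
  by move=> PQ; subst Q; congr (sval (cid _)); apply: Prop_irrelevance.
exact: cidE.
Qed.

(* Representatives rather than classes: the sets [theta a] live in a universe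
   above that of the carriers. *)
Definition quot_carrier := {a : A | quot_repr a = a}.

Lemma quot_repr_idem a : quot_repr (quot_repr a) = quot_repr a.
Proof. exact/quot_reprE/crel_sym/quot_repr_crel. Qed.

Definition quot_class (a : A) : quot_carrier :=
  exist _ (quot_repr a) (quot_repr_idem a).

Lemma quot_classE a b : quot_class a = quot_class b <-> theta a b.
Proof.
rewrite -quot_reprE; split=> [/(congr1 sval) //|ab]; exact: eq_exist.
Qed.

Lemma quot_classK c : quot_class (sval c) = c.
Proof. by case: c => a aE; apply: eq_exist. Qed.

Definition quot_algebra : algebra tau :=
  @Algebra tau quot_carrier
    (fun f args => quot_class (op A f (fun i => sval (args i))))
    (let: inhabits a := carrier_inhabited A in inhabits (quot_class a)).

Lemma quot_class_op f (args : 'I_(arity f) -> A) :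
  quot_class (op A f args) = op quot_algebra f (fun i => quot_class (args i)).
Proof.
apply/quot_classE; apply: crel_op => i; apply/quot_classE.
by rewrite quot_classK.
Qed.

Definition quot_hom0 : hom A quot_algebra :=
  @Hom tau A quot_algebra quot_class quot_class_op.

Lemma quot_class_surj : surjective_hom quot_hom0.
Proof. by move=> c; exists (sval c); apply: quot_classK. Qed.

Lemma quot_identities e : identities V e -> satisfies quot_algebra e.
Proof.
by move=> /(memberP (m := A)); apply: satisfies_surj quot_class_surj.
Qed.

Definition quot : member V := Member quot_identities.
Definition quot_hom : hom A quot := quot_hom0.

Lemma quot_hom_surj : surjective_hom quot_hom.
Proof. exact: quot_class_surj. Qed.

Lemma cker_quot_hom : cker quot_hom = theta.
Proof. by apply: congruence_ext => x y; apply: quot_classE. Qed.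

End Quotient.

(** * The commutator: behaviour under surjections and monotonicity *)

Section Commutator.
Context {tau : signature} {V : variety tau}.

Lemma commutator_surj (A B : member V) (h : hom A B)
    (alpha beta : congruence A) :
    surjective_hom h ->
  commutator alpha beta `|` cker h =
    cpreim h (commutator (cimage h (alpha `|` cker h))
                         (cimage h (beta `|` cker h))).
Proof.
move=> hs; have [C _] := commutator_greatest V.
by have [_ ->] := C A B h hs alpha beta.
Qed.

(* Both sides are the preimage of one commutator in the quotient by [phi]. *)
Lemma commutator_joinl (A : member V) (phi alpha beta : congruence A) :
  commutator (phi `|` alpha) (phi `|` beta) `|` phi =
  commutator alpha beta `|` phi.
Proof.
rewrite -{3 4}(cker_quot_hom phi) !commutator_surj; try exact: quot_hom_surj.
by rewrite cker_quot_hom ![phi `|` _]joinC -!joinA joinxx.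
Qed.

Lemma cker_le_cpreim (A B : algebra tau) (h : hom A B) (theta : congruence B) :
  cker h <= cpreim h theta.
Proof. by apply/cleP => x y /= ->; apply: crel_refl. Qed.

Lemma cpreim_le (A B : algebra tau) (h : hom A B) (theta eta : congruence B) :
  theta <= eta -> cpreim h theta <= cpreim h eta.
Proof. by move=> /cleP te; apply/cleP => x y /te. Qed.

Lemma cimage_le (A B : algebra tau) (h : hom A B) (theta eta : congruence A) :
  theta <= eta -> cimage h theta <= cimage h eta.
Proof.
move=> /cleP te; apply/cleP => u v uv g gE; apply: uv => _ [x [y [/te xy ->]]].
by apply: gE; exists x, y.
Qed.

Lemma cpreimK (A B : algebra tau) (h : hom A B) (theta : congruence B) :
  surjective_hom h -> cimage h (cpreim h theta) = theta.
Proof.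
move=> hs; apply: congruence_ext => u v.
split=> [/(cimageE _ _ hs (cker_le_cpreim h theta))[x [y [xy -> ->]]] //|].
have [x <-] := hs u; have [y <-] := hs v => xy.
by apply/cimageE => //; [apply: cker_le_cpreim | exists x, y].
Qed.

Lemma cimageK (A B : algebra tau) (h : hom A B) (theta : congruence A) :
  surjective_hom h -> cker h <= theta -> cpreim h (cimage h theta) = theta.
Proof.
move=> hs kt; apply: congruence_ext => x y; split=> [|xy].
  move/(cimageE _ _ hs kt) => [x' [y' [xy' ex ey]]]; move/cleP: kt => kt.
  by apply: crel_trans (kt x x' ex) _; apply: crel_trans xy' _; apply: kt.
by apply/cimageE => //; exists x, y.
Qed.

(** Monotone by construction and above [commutator]; once it is a commutator operation, maximality
    forces the two to agree. *)
Definition commutator_hull (A : member V) (alpha beta : congruence A) :=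
  csup [set g : congruence A | exists a b,
         [/\ a <= alpha, b <= beta & g = commutator a b]].

Lemma commutator_hull_operation :
  congruence_modular V -> commutator_operation commutator_hull.
Proof.
move=> modV A B h hs alpha beta; split.
  apply: csup_le => _ [a [b [aa bb ->]]].
  by apply: le_trans (commutator_le a b) _; apply: leI2.
set a' := cimage h _; set b' := cimage h _.
apply/le_anti/andP; split.
  rewrite leUx cker_le_cpreim andbT.
  apply: csup_le => _ [a [b [aa bb ->]]].
  apply: (@le_trans _ _ (commutator a b `|` cker h)); first exact: leUl.
  rewrite commutator_surj //; apply/cpreim_le/csup_ub.
  by exists (cimage h (a `|` cker h)), (cimage h (b `|` cker h));
    split=> //; apply: cimage_le; rewrite leU2.
set g := _ `|` cker h; have kg : cker h <= g by exact: leUr.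
rewrite -[g](cimageK hs kg); apply/cpreim_le/csup_le => _ [c [d [ca db ->]]].
(* To realise [c] and [d] from below [alpha] and [beta], their preimages are cut down to these. By
   the modular law, joining the kernel back restores the full preimage, which lies between [cker h]
   and [eta] joined with [cker h]. *)
pose lift (gamma : congruence B) eta := eta `&` cpreim h gamma.
have liftE gamma eta : gamma <= cimage h (eta `|` cker h) ->
    cimage h (lift gamma eta `|` cker h) = gamma.
  move=> le; rewrite /lift joinC modV ?cker_le_cpreim // [cker h `|` _]joinC.
  rewrite (elimT meet_idPr) ?cpreimK //.
  by rewrite -[leRHS](@cimageK _ _ h) ?leUr //; apply: cpreim_le.
rewrite -[commutator c d](@cpreimK _ _ h) //; apply: cimage_le.
rewrite -(liftE _ _ ca) -(liftE _ _ db) -commutator_surj // leU2 //.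
by apply: csup_ub; exists (lift c alpha), (lift d beta); split; rewrite ?leIl.
Qed.

Lemma commutatorS (A : member V) (a b alpha beta : congruence A) :
  congruence_modular V -> a <= alpha -> b <= beta ->
  commutator a b <= commutator alpha beta.
Proof.
move=> modV aa bb; have [_ max] := commutator_greatest V.
apply: le_trans (max _ (commutator_hull_operation modV) _ _ _).
by apply: csup_ub; exists a, b.
Qed.

End Commutator.

(** * Finitely generated congruences as compact elements *)

Section FinitelyGenerated.
Context {tau : signature} {A : algebra tau}.
Implicit Types (alpha beta theta : congruence A) (S : set (congruence A)).

Definition cprin (p : A * A) : congruence A := cgen [set p].

Lemma cprin_le p theta : cprin p <= theta <-> theta p.1 p.2.
Proof.
split=> [/cleP|tp]; last by apply: cinf_lb => _ ->.
by apply=> g; apply.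
Qed.

Lemma cgen_le (X : set (A * A)) theta :
  cgen X <= theta <-> (forall p, X p -> theta p.1 p.2).
Proof.
split=> [/cleP h p Xp|tX]; last exact: cinf_lb.
by apply: h => g; apply.
Qed.

Lemma joins_prin_le (s : seq (A * A)) theta :
  \join_(p <- s) cprin p <= theta <->
  (forall p, (p \in (s : seq {classic A * A})) -> theta p.1 p.2).
Proof.
elim: s => [|q s IH]; first by rewrite big_nil le0x; split.
rewrite big_cons leUx; split=> [/andP[/cprin_le qt /IH st] p|h].
  by rewrite inE => /orP[/eqP ->|/st].
apply/andP; split; first by apply/cprin_le; apply: h; rewrite mem_head.
by apply/IH => p ps; apply: h; rewrite inE ps orbT.
Qed.

Lemma le_ext alpha beta :
  (forall theta, alpha <= theta <-> beta <= theta) -> alpha = beta.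
Proof. by move=> h; apply/le_anti/andP; split; apply/h. Qed.

(** Lists of generating pairs allow induction on the generators; [{classic A * A}] supplies the
    equality test behind list membership. *)
Lemma finitely_generatedP theta : finitely_generated theta <->
  exists s : seq (A * A), theta = \join_(p <- s) cprin p.
Proof.
split=> [[X /(@finite_seqP {classic A * A})[s Xs] ->]|[s ->]].
  exists s; apply: le_ext => g; rewrite cgen_le joins_prin_le Xs.
  by [].
exists [set` (s : seq {classic A * A})].
  exact: (@finite_seq {classic A * A} s).
by apply: le_ext => g; rewrite cgen_le joins_prin_le.
Qed.

Lemma finitely_generated_prin p : finitely_generated (cprin p).
Proof. by apply/finitely_generatedP; exists [:: p]; rewrite big_seq1. Qed.

Lemma finitely_generated0 : finitely_generated (\bot : congruence A).
Proof. by apply/finitely_generatedP; exists [::]; rewrite big_nil. Qed.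

Lemma finitely_generatedU alpha beta : finitely_generated alpha ->
  finitely_generated beta -> finitely_generated (alpha `|` beta).
Proof.
move=> /finitely_generatedP[s ->] /finitely_generatedP[t ->].
by apply/finitely_generatedP; exists (s ++ t); rewrite big_cat.
Qed.

Definition directed S :=
  S !=set0 /\ forall alpha beta, S alpha -> S beta ->
    exists gamma, [/\ S gamma, alpha <= gamma & beta <= gamma].

(** With [n] the arity of an operation, this puts all pairs of arguments into one member of [S]. *)
Lemma directed_bound S n (P : 'I_n -> congruence A -> Prop) : directed S ->
  (forall i alpha beta, alpha <= beta -> P i alpha -> P i beta) ->
  (forall i, exists alpha, S alpha /\ P i alpha) ->
  exists alpha, S alpha /\ forall i, P i alpha.
Proof.
move=> [[a0 Sa0] dS]; elim: n P => [|n IH] P Pup PS.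
  by exists a0; split=> // -[].
have [a [Sa Pa]] := PS ord0.
have [||b [Sb Pb]] := IH (fun i => P (lift ord0 i)).
- by move=> i; apply: Pup.
- by move=> i; apply: PS.
have [c [Sc ac bc]] := dS _ _ Sa Sb; exists c; split=> // i.
by have [j ->|->] := unliftP ord0 i; [apply: Pup bc (Pb j) | apply: Pup ac Pa].
Qed.

(** Operations are finitary, so the union of a directed family is already a congruence. *)
Lemma csup_directed S x y : directed S ->
  csup S x y <-> exists theta, S theta /\ theta x y.
Proof.
move=> dS; have [[a0 Sa0] dU] := dS; split; last first.
  by move=> [theta [St txy]]; move: x y txy; apply/cleP/csup_ub.
pose r x y := exists theta, S theta /\ theta x y.
have r1 x0 : r x0 x0 by exists a0; split=> //; apply: crel_refl.
have r2 x0 y0 : r x0 y0 -> r y0 x0.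
  by move=> [t [St xy]]; exists t; split=> //; apply: crel_sym.
have r3 x0 y0 z0 : r x0 y0 -> r y0 z0 -> r x0 z0.
  move=> [t [St xy]] [u [Su yz]].
  have [w [Sw /cleP tw /cleP uw]] := dU _ _ St Su.
  by exists w; split=> //; apply: crel_trans (tw _ _ xy) (uw _ _ yz).
have r4 f (a b : 'I_(arity f) -> A) :
    (forall i, r (a i) (b i)) -> r (op A f a) (op A f b).
  move=> ab.
  have [|t [St tab]] := @directed_bound S _ (fun i t => t (a i) (b i)) dS _ ab.
  by move=> i t u /cleP /=; apply.
  by exists t; split=> //; apply: crel_op.
suff /cleP : csup S <= Congruence r1 r2 r3 r4 by apply.
by apply: csup_le => t St; apply/cleP => x0 y0 xy; exists t.
Qed.

Lemma finitely_generated_compact alpha S : finitely_generated alpha ->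
  directed S -> alpha <= csup S -> exists theta, S theta /\ alpha <= theta.
Proof.
move=> /finitely_generatedP[s ->] dS; elim: s => [|p s IH].
  by have [[a0 Sa0] _] := dS; exists a0; rewrite big_nil le0x.
rewrite big_cons leUx.
move=> /andP[/cprin_le/(csup_directed _ _ dS)[t [St /cprin_le pt]]].
move=> /IH[u [Su su]].
have [_ dU] := dS; have [w [Sw tw uw]] := dU _ _ St Su.
by exists w; rewrite leUx (le_trans pt tw) (le_trans su uw).
Qed.

Lemma directed_fg_below theta :
  directed [set gamma | finitely_generated gamma /\ gamma <= theta].
Proof.
split; first by exists \bot; split; [apply: finitely_generated0 | rewrite le0x].
move=> a b [fa at_] [fb bt]; exists (a `|` b).
rewrite leUl leUr; split=> //; split; first exact: finitely_generatedU.
by rewrite leUx at_.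
Qed.

(** Algebraicity of the congruence lattice: each pair in [theta] generates a principal congruence
    below it. *)
Lemma csup_fg theta :
  csup [set gamma | finitely_generated gamma /\ gamma <= theta] = theta.
Proof.
apply/le_anti/andP; split; first by apply: csup_le => ? [].
apply/cleP => x y xy; apply/csup_directed; first exact: directed_fg_below.
exists (cprin (x, y)); split; last exact: (cprin_le (x, y) _).1 (lexx _).
by split; [apply: finitely_generated_prin | apply/cprin_le].
Qed.

End FinitelyGenerated.

(* Modulo the pairs (a, f(a, ..., a)) the class of [a] is a one-element
   subalgebra, so the quotient is trivial. *)
Lemma finitely_generated_top (tau : signature) (V : variety tau)
    (A : member V) :
  semidegenerate V -> finitely_generated (\top : congruence A).
Proof.
move=> sdV; have [a] := carrier_inhabited A.
pose diag f := (a, op A f (fun=> a)).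
(* One pair per symbol: the set is finite because the signature is. *)
exists (range diag); first exact/finite_image/finite_finset.
set theta := cgen _; apply/esym/le_anti; rewrite lex1 /=.
apply/cleP => x y _; apply/quot_classE; apply: contrapT => xy.
apply: (sdV (quot theta)).
  by exists (quot_class theta x), (quot_class theta y).
exists (quot_class theta a) => f args argsE.
have -> : args = fun i => quot_class theta a by apply/funext => i; apply: argsE.
apply: etrans (esym (@quot_class_op _ _ _ theta f (fun=> a))) _.
apply/quot_classE; apply: crel_sym; move: f {args argsE} => f.
by move=> g /(_ (diag f)); apply; exists f.
Qed.

(** * Prime separation and finitely generated cores *)

Section Separation.
Context {tau : signature} {V : variety tau} (A : member V).
Hypothesis modV : congruence_modular V.
Implicit Types (alpha beta gamma theta phi : congruence A).

(** [S] plays the role of a multiplicative set. Zorn's lemma yields a maximal congruence above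
    [theta] with no member of [S] below it; compactness of these members makes the condition survive
    joins of chains. *)
Lemma prime_separation (S : set (congruence A)) theta :
  S !=set0 -> S `<=` finitely_generated ->
  (forall a b, S a -> S b -> exists c, S c /\ c <= commutator a b) ->
  (forall c, S c -> ~ c <= theta) ->
  exists phi, [/\ prime_congruence phi, theta <= phi &
                  forall c, S c -> ~ c <= phi].
Proof.
move=> [s0 Ss0] Sfg Scomm St.
pose T := {phi : congruence A | theta <= phi /\ forall c, S c -> ~ c <= phi}.
pose mkT phi (tphi : theta <= phi) (Sphi : forall c, S c -> ~ c <= phi) : T :=
  exist _ phi (conj tphi Sphi).
have [||||[phi [tphi Sphi]] max] := @Zorn T (fun s t => sval s <= sval t).
- by move=> t.
- by move=> r s t; apply: le_trans.
- move=> [s ps] [t pt] /= st ts; apply: eq_exist.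
  by apply/le_anti; rewrite st ts.
- move=> C Ctot; have [C0|/set0P C0] := eqVneq C set0.
    by exists (mkT _ (lexx theta) St) => s; rewrite C0.
  have Cdir : directed [set sval t | t in C].
    split; first by have [t Ct] := C0; exists (sval t), t.
    move=> _ _ [s Cs <-] [t Ct <-]; have [st|ts] := Ctot _ _ Cs Ct.
      by exists (sval t); split=> //; exists t.
    by exists (sval s); split=> //; exists s.
  have Cub : theta <= csup [set sval t | t in C].
    have [t Ct] := C0; have [tt _] := svalP t.
    by apply: le_trans tt _; apply: csup_ub; exists t.
  have CS c : S c -> ~ c <= csup [set sval t | t in C].
    move=> Sc /(finitely_generated_compact (Sfg _ Sc) Cdir)[_ [[t Ct <-] ct]].
    by have [_ /(_ c Sc)] := svalP t.
  by exists (mkT _ Cub CS) => t Ct; apply: csup_ub; exists t.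
exists phi; split=> //; split=> [phi1|a b abphi].
  by apply: (Sphi s0 Ss0); rewrite phi1 lex1.
(* By maximality, any proper enlargement of [phi] lies above a member of [S]. *)
have above c : ~ c <= phi -> exists s, S s /\ s <= phi `|` c.
  move=> cphi; apply: contrapT => h; apply: cphi.
  have tc : theta <= phi `|` c by apply: le_trans tphi (leUl _ _).
  have Sc s : S s -> ~ s <= phi `|` c by move=> Ss sc; apply: h; exists s.
  have /(congr1 sval) /= E := max (mkT _ tc Sc) (leUl _ _).
  by rewrite -E leUr.
apply: contrapT => /not_orP[/above[s [Ss sa]] /above[t [St' tb]]].
(* This member of [S] lies below the commutator of the two enlargements, which modulo [phi] is that
   of [a] and [b], hence below [phi]. *)
have [c [Sc cst]] := Scomm _ _ Ss St'; apply: (Sphi c Sc).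
apply: le_trans cst _; apply: le_trans (commutatorS modV sa tb) _.
apply: le_trans (leUl _ phi) _.
by rewrite commutator_joinl leUx abphi lexx.
Qed.

(** The condition that quasi-commutativity imposes on commutators of principal congruences, stated
    for any congruence so that it can be propagated. *)
Definition fg_core theta := exists gamma : congruence A,
  [/\ finitely_generated gamma, gamma <= theta & radical gamma = radical theta].

Lemma fg_coreP theta : fg_core theta <-> exists gamma,
  [/\ finitely_generated gamma, gamma <= theta &
      forall phi, prime_congruence phi -> gamma <= phi -> theta <= phi].
Proof.
split=> -[g [fg gt h]]; exists g; split=> //.
  by move=> phi pp; apply: (iffLR (iffLR (radicalP _ _) h phi pp)).
apply/radicalP => phi pp; split; first exact: h.
exact: le_trans.
Qed.

(** Monotonicity puts the join of the two cores below the commutator; a prime above both cores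
    contains [c], or both [a] and [b]. *)
Lemma fg_core_commutatorUl a b c : fg_core (commutator a c) ->
  fg_core (commutator b c) -> fg_core (commutator (a `|` b) c).
Proof.
move=> /fg_coreP[g [fg ga gP]] /fg_coreP[h [fh hb hP]]; apply/fg_coreP.
exists (g `|` h); split; first exact: finitely_generatedU.
  by rewrite leUx (le_trans ga) ?(le_trans hb) ?commutatorS ?leUl ?leUr.
move=> phi pp; rewrite leUx => /andP[/(gP _ pp) + /(hP _ pp)].
rewrite !(prime_commutator _ _ pp) leUx => -[aphi|cphi]; last by right.
by case=> [->|cphi]; [left; rewrite aphi | right].
Qed.

Lemma fg_core_commutatorUr a b c : fg_core (commutator c a) ->
  fg_core (commutator c b) -> fg_core (commutator c (a `|` b)).
Proof.
move=> /fg_coreP[g [fg ga gP]] /fg_coreP[h [fh hb hP]]; apply/fg_coreP.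
exists (g `|` h); split; first exact: finitely_generatedU.
  by rewrite leUx (le_trans ga) ?(le_trans hb) ?commutatorS ?leUl ?leUr.
move=> phi pp; rewrite leUx => /andP[/(gP _ pp) + /(hP _ pp)].
rewrite !(prime_commutator _ _ pp) leUx => -[cphi|aphi]; first by left.
by case=> [cphi|->]; [left | right; rewrite aphi].
Qed.

Lemma fg_core_le_bot theta : theta <= \bot -> fg_core theta.
Proof.
move=> t0; apply/fg_coreP; exists \bot; split; rewrite ?le0x //.
  exact: finitely_generated0.
by move=> phi _ _; apply: le_trans t0 (le0x _).
Qed.

Lemma fg_core_commutator alpha beta : quasi_commutative A ->
  finitely_generated alpha -> finitely_generated beta ->
  fg_core (commutator alpha beta).
Proof.
move=> qc /finitely_generatedP[s ->] /finitely_generatedP[t ->].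
have cl (a b : congruence A) : commutator a b <= a /\ commutator a b <= b.
  by apply/andP; rewrite -lexI commutator_le.
elim: s => [|p s IHs].
  rewrite big_nil; apply: fg_core_le_bot.
  by case: (cl \bot (\join_(q <- t) cprin q)).
rewrite big_cons; apply: fg_core_commutatorUl IHs.
elim: t => [|q t IHt].
  by rewrite big_nil; apply: fg_core_le_bot; case: (cl (cprin p) \bot).
rewrite big_cons; apply: fg_core_commutatorUr IHt.
by apply: qc; [exists p.1, p.2 | exists q.1, q.2]; rewrite -surjective_pairing.
Qed.

Lemma fg_core_closure theta : quasi_commutative A ->
  commutator_closure theta -> fg_core theta.
Proof.
move=> qc; apply: smallest_sub => [a b|a fa]; last by exists a.
move=> /fg_coreP[g [fg ga gP]] /fg_coreP[h [fh hb hP]]; split; apply/fg_coreP.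
  exists (g `|` h); split; rewrite ?leU2 //; first exact: finitely_generatedU.
  by move=> phi pp; rewrite !leUx => /andP[/(gP _ pp) -> /(hP _ pp) ->].
(* The cores [g] and [h] are finitely generated, so their commutator has a core, which also serves
   for [a] and [b]. *)
have /fg_coreP[k [fk kc kP]] := fg_core_commutator qc fg fh.
exists k; split=> //; first exact: le_trans kc (commutatorS modV ga hb).
move=> phi pp /(kP _ pp); rewrite !(prime_commutator _ _ pp).
by case=> [/(gP _ pp)|/(hP _ pp)]; [left | right].
Qed.

(** Otherwise prime separation, applied to the finitely generated congruences with the radical of
    [alpha], gives a prime above [theta] but not above [alpha]. *)
Lemma fg_core_prime_cover alpha theta : quasi_commutative A ->
  finitely_generated alpha ->
  (forall phi, prime_congruence phi -> theta <= phi -> alpha <= phi) ->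
  exists gamma, [/\ finitely_generated gamma, gamma <= theta &
                    radical gamma = radical alpha].
Proof.
move=> qc fa cov; apply: contrapT => none.
have [||||phi [pp tphi]] := @prime_separation
  [set c | finitely_generated c /\ radical c = radical alpha] theta.
- by exists alpha.
- by move=> c [].
- move=> a b [fa' /radicalP ra] [fb /radicalP rb].
  have [c [fc cab /radicalP rc]] := fg_core_commutator qc fa' fb.
  exists c; split=> //; split=> //; apply/radicalP => phi pp.
  by rewrite (rc _ pp) (prime_commutator _ _ pp) (ra _ pp) (rb _ pp); tauto.
- by move=> c [fc rc] ct; apply: none; exists c.
by move/(_ alpha (conj fa erefl)); apply; apply: cov.
Qed.

End Separation.

(** * The topology of the prime spectrum *)

Section SpectralTopology.
Local Open Scope classical_set_scope.
Context {tau : signature} {V : variety tau} (A : member V).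
Implicit Types (alpha beta theta : congruence A) (phi : spec A).

Lemma spec_prime phi : prime_congruence (val phi).
Proof. exact: set_mem (valP phi). Qed.

Lemma open_spec_open theta : open (spec_open theta : set (spec A)).
Proof. by rewrite open_specE; exists theta. Qed.

Lemma spec_open_eq alpha beta : radical alpha = radical beta ->
  spec_open alpha = spec_open beta :> set (spec A).
Proof.
move=> /radicalP h; apply/seteqP; split=> phi /=;
  by rewrite /spec_open /= (h _ (spec_prime phi)).
Qed.

Lemma spec_openC alpha beta :
  spec_open (commutator alpha beta) =
  spec_open alpha `&` spec_open beta :> set (spec A).
Proof.
apply/seteqP; split=> phi /=;
  rewrite /spec_open /= (prime_commutator _ _ (spec_prime phi)).
- by move=> /not_orP.
- by move=> ?; apply/not_orP.
Qed.

Lemma compact_spec_open_fg_core theta :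
  cover_compact (spec_open theta : set (spec A)) -> fg_core theta.
Proof.
move=> /(_ _ [set c | finitely_generated c /\ c <= theta] (@spec_open _ _ A)).
case=> [c _|phi tphi|D' D'D cov]; first exact: open_spec_open.
  apply: contrapT => h; apply: tphi; rewrite -[theta]csup_fg.
  by apply: csup_le => c Dc; apply: contrapT => cphi; apply: h; exists c.
have D'P c : c \in D' -> finitely_generated c /\ c <= theta.
  by move=> /D'D/set_mem.
apply/fg_coreP; exists (\join_(c <- D') c); split.
- rewrite big_seq; elim/big_ind: _ => [||c /D'P[] //].
    exact: finitely_generated0.
  exact: finitely_generatedU.
- by apply/joinsP_seq => c /D'P[].
- move=> phi pp /joinsP_seq le; apply: contrapT => tphi.
  by have [c cD'] := cov (SigSub (mem_set pp)) tphi; apply; apply: le.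
Qed.

Lemma closed_spec (F : set (spec A)) : closed F <->
  exists theta, F = [set phi | theta <= val phi].
Proof.
have CE t : ~` spec_open t = [set phi | t <= val phi] :> set (spec A).
  by apply/seteqP; split=> phi; [apply: contrapT | move=> tphi; apply].
rewrite -openC open_specE; split=> [[t _ tE]|[t ->]]; exists t => //.
by rewrite -CE tE setCK.
Qed.

(** The generic point is the intersection [m] of all primes in [F]. If [m] contains a commutator,
    each prime in [F] contains one of its arguments; this splits [F] into two closed pieces, and
    irreducibility makes one of them all of [F]. *)
Lemma spec_sober (F : set (spec A)) : closed F -> irreducible_set F ->
  exists x, F = closure [set x].
Proof.
move=> /[dup] cF /closed_spec[t FE] [[x0 Fx0] Firr].
pose m := cinf [set val phi | phi in F].
have tm : t <= m by apply: le_cinf => _ [phi + <-]; rewrite FE.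
have mF phi : F phi -> m <= val phi by move=> Fphi; apply: cinf_lb; exists phi.
have mprime : prime_congruence m.
  split=> [m1|a b abm].
    by have [+ _] := spec_prime x0; apply; apply/eqP; rewrite -le1x -m1 mF.
  have Fle c : F = F `&` [set phi | c <= val phi] -> c <= m.
    by move=> E; apply: le_cinf => _ [phi + <-]; rewrite E => -[].
  have cl c : closed (F `&` [set phi | c <= val phi]).
    by apply: closedI => //; apply/closed_spec; exists c.
  have [|/Fle|/Fle] := Firr _ _ (cl a) (cl b); last 2 first.
  - by left.
  - by right.
  apply/seteqP; split=> phi; last by case=> -[].
  move=> Fphi; have := le_trans abm (mF _ Fphi).
  by move=> /(prime_commutator _ _ (spec_prime phi))[]; [left | right].
pose x : spec A := SigSub (mem_set mprime).
exists x; apply/seteqP; split=> phi Fphi.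
  rewrite closureE => B [/closed_spec[s ->] sx].
  by apply: le_trans (mF _ Fphi); apply: (sx x).
have : [set x] `<=` F by move=> _ ->; rewrite FE.
by move=> /closureS/(_ _ Fphi); rewrite -(iffLR (closure_id F) cF).
Qed.

Hypothesis modV : congruence_modular V.

(** Being a cover means that every prime above the join of all [t i] is above [alpha]. Then some
    finitely generated [c] below this join has the same open set as [alpha], and compactness of [c]
    leaves finitely many indices. *)
Lemma fg_spec_open_compact alpha : quasi_commutative A ->
  finitely_generated alpha -> cover_compact (spec_open alpha : set (spec A)).
Proof.
move=> qc fa I D f fo cov.
have /choice[t tE] i : exists theta, D i -> spec_open theta = f i.
  (* Outside [D] the value [\bot] is a mere default. *)
  have [Di|nDi] := pselect (D i); last by exists \bot.
  by have [theta _ <-] := fo i Di; exists theta.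
pose S := [set \join_(i <- s) t i |
           s in [set s : seq I | forall i, i \in s -> D i]].
have dS : directed S.
  split; first by exists \bot, [::]; rewrite ?big_nil.
  move=> _ _ [s sD <-] [u uD <-]; exists (\join_(i <- s ++ u) t i).
  rewrite big_cat leUl leUr; split=> //.
  exists (s ++ u); last by rewrite big_cat.
  by move=> i; rewrite mem_cat => /orP[/sD|/uD].
have [|c [fc cS rc]] := fg_core_prime_cover modV qc fa (theta := csup S).
  move=> phi pp Sphi; apply: contrapT => aphi.
  have [i Di] := cov (SigSub (mem_set pp)) aphi; rewrite -tE //; apply.
  apply: le_trans Sphi; apply: csup_ub; exists [:: i]; rewrite ?big_seq1 //.
  by move=> j; rewrite inE => /eqP ->.
have [_ [[s sD <-] cs]] := finitely_generated_compact fc dS cS.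
exists [fset i in s]%fset => [i|phi].
  by rewrite !inE => /sD.
rewrite -(spec_open_eq rc) => cphi; apply: contrapT => h; apply: cphi.
apply: le_trans cs _; apply/joinsP_seq => i si _; apply: contrapT => tphi.
by apply: h; exists i; [rewrite /= !inE | rewrite -tE //; apply: sD].
Qed.

Lemma quasi_commutative_spectral : finitely_generated (\top : congruence A) ->
  quasi_commutative A -> spectral_algebra A.
Proof.
move=> f1 qc; split; last by move=> alpha; apply: fg_spec_open_compact.
split.
- rewrite -[setT](_ : spec_open \top = _); first exact: fg_spec_open_compact.
  apply/seteqP; split=> // phi _ /=.
  by have [+ _] := spec_prime phi; apply: contra_not; rewrite le1x => /eqP.
- have sep (x y : spec A) : ~ val x <= val y ->
      spec_open (val x) \in nbhs y /\ x \in ~` spec_open (val x).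
    move=> xy; split; rewrite inE; last by move=> /(_ (lexx _)).
    by apply: open_nbhs_nbhs; split; first exact: open_spec_open.
  move=> x y xy; have [xley|/sep] := pselect (val x <= val y); last first.
    by exists (spec_open (val x)); right.
  exists (spec_open (val y)); left; apply: sep => ylex; move/eqP: xy; apply.
  by apply/val_inj/le_anti; rewrite xley.
- split=> [U [] //|phi U].
  rewrite nbhsE => -[_ [[theta _ <-] tphi] sU].
  (* Since [theta] is the join of its finitely generated parts, one of them already avoids [phi]. *)
  have [c [fc ct cphi]] : exists c : congruence A,
      [/\ finitely_generated c, c <= theta & ~ c <= val phi].
    apply: contrapT => h; apply: tphi; rewrite -[theta]csup_fg.
    apply: csup_le => c [fc ct]; apply: contrapT => cphi.
    by apply: h; exists c.
  exists (spec_open c); last first.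
    by apply: subset_trans sU => psi; apply: contra_not; apply: le_trans.
  by do !split=> //; [apply: open_spec_open | apply: fg_spec_open_compact].
- move=> U W [oU cU] [oW cW]; split; first exact: openI.
  move: oU cU oW cW; rewrite open_specE => -[a _ <-] + [b _ <-].
  (* Both compact open sets come from finitely generated congruences; their intersection is the open
     set of a commutator, hence of its core. *)
  move=> /compact_spec_open_fg_core[a' [fa _ ra]].
  move=> /compact_spec_open_fg_core[b' [fb _ rb]].
  rewrite -(spec_open_eq ra) -(spec_open_eq rb) -spec_openC.
  have [c [fc _ rc]] := fg_core_commutator modV qc fa fb.
  by rewrite -(spec_open_eq rc); apply: fg_spec_open_compact.
- exact: spec_sober.
Qed.

End SpectralTopology.

(** The open set of a commutator is the intersection of two compact open sets, hence compact, and
    compactness yields a core. *)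
Lemma spectral_quasi_commutative (tau : signature) (V : variety tau)
    (A : member V) : spectral_algebra A -> quasi_commutative A.
Proof.
move=> [[_ _ _ cI _] cD] alpha beta [a1 [a2 ->]] [b1 [b2 ->]].
apply: compact_spec_open_fg_core; rewrite spec_openC.
by apply: (cI _ _ _ _).2; split; try exact: open_spec_open;
  apply: cD; apply: finitely_generated_prin.
Qed.

(** * Ideals of the reticulation *)

Section Ideals.
Context {tau : signature} {V : variety tau} (A : member V).
Implicit Types (a b : ccl A) (I : set (reticulation A)).

Lemma ccl_of (gamma : congruence A) : commutator_closure gamma ->
  exists a, val a = gamma.
Proof. by move=> cg; exists (SigSub (mem_set cg)). Qed.

Lemma ccl_of_fg (gamma : congruence A) : finitely_generated gamma ->
  exists a, val a = gamma.
Proof. by move=> fg; apply: ccl_of; apply: sub_gen_smallest. Qed.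

Lemma lam_le a b : lam a <= lam b <->
  forall phi, prime_congruence phi -> val b <= phi -> val a <= phi.
Proof.
rewrite -(rwP meet_idPl) [lam a `&` lam b](ret_meetE a b) lamP.
split=> h phi pp; have := h phi pp; rewrite ccl_commE //.
  by move=> [le _] bphi; apply: le; rewrite bphi orbT.
by move=> ba; split=> [/orP[]|->].
Qed.

Lemma lamU a b : lam a `|` lam b = lam (ccl_join a b).
Proof. exact: ret_joinE. Qed.

Lemma quasi_commutative_star_costar I : congruence_modular V ->
  quasi_commutative A -> lattice_ideal I -> I = star (costar I).
Proof.
move=> modV qc [I0 IU Idown].
(* Every class of the reticulation has a finitely generated representative, so [costar] loses no
   element of [I]. *)
have core a : exists b,
    [/\ finitely_generated (val b), val b <= val a & lam b = lam a].
  have [g [fg ga rg]] := fg_core_closure modV qc (set_mem (valP a)).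
  have [b bE] := ccl_of_fg fg; exists b; rewrite bE; split=> //.
  by apply/lamP/radicalP; rewrite bE.
apply/seteqP; split=> [x|_ [a aI <-]].
  rewrite -[x]lam_repr => Ix; have [b [fb _ bE]] := core (repr x).
  exists b => //=; apply: csup_ub; exists b => //.
  by split=> //; rewrite bE.
have [b [fb ba bE]] := core a; rewrite -bE.
(* The family defining [costar I] is directed because [I] is an ideal, so the compact [b] lies below
   one of its members. *)
have [|_ [[c [_ Ic] <-] bc]] :=
  finitely_generated_compact fb _ (le_trans ba aI).
  split.
    exists \bot, (ccl_bot A) => //; split; last exact: I0.
    exact: finitely_generated0.
  move=> _ _ [c [fc Ic] <-] [d [fd Id] <-]; exists (val c `|` val d).
  rewrite leUl leUr; split=> //; exists (ccl_join c d) => //.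
  by split; [apply: finitely_generatedU | rewrite -lamU; apply: IU].
by apply: Idown Ic; apply/lam_le => phi _; apply: le_trans bc.
Qed.

Lemma star_costar_quasi_commutative :
  (forall I, lattice_ideal I -> I = star (costar I)) -> quasi_commutative A.
Proof.
move=> h alpha beta [a1 [a2 ->]] [b1 [b2 ->]].
set ab := commutator _ _.
have [c cE] : exists c : ccl A, val c = ab.
  by apply: ccl_of; apply: commutator_closureC; apply: sub_gen_smallest;
    apply: finitely_generated_prin.
(* In contrast with the principal ideal of [lam c], membership in [I] is
   witnessed by a finitely generated congruence below [ab] itself. *)
pose I := [set x | exists g : ccl A,
  [/\ finitely_generated (val g), val g <= ab & x <= lam g]].
have II : lattice_ideal I.
  split.
  - exists (ccl_bot A); rewrite /= le0x; split=> //; exact: finitely_generated0.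
  - move=> x y [g [fg ga xg]] [k [fk ka yk]]; exists (ccl_join g k).
    rewrite -lamU leU2 // ccl_joinE ga ka; split=> //.
    exact: finitely_generatedU.
  - by move=> x y xy [g [fg ga yg]]; exists g; split=> //; apply: le_trans yg.
have Ic : I (lam c).
  (* It suffices that [ab] lies below [costar I], and [ab] is the join of the finitely generated
     congruences whose classes generate [I]. *)
  rewrite (h I II); exists c => //=; rewrite cE -[leLHS]csup_fg.
  apply: csup_le => k [fk kab]; apply: csup_ub.
  by have [g gE] := ccl_of_fg fk; exists g => //; split;
    [rewrite gE | exists g; rewrite gE].
have [g [fg gab /lam_le cg]] := Ic; apply/fg_coreP.
by exists (val g); split=> // phi pp gphi; rewrite -cE; apply: cg.
Qed.

End Ideals.

Theorem theorem3p26 (tau : signature) (V : variety tau)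
    (modV : congruence_modular V) (sdV : semidegenerate V) (A : member V) :
  (spectral_algebra A <-> quasi_commutative A) /\
  (quasi_commutative A <->
   forall I : set (reticulation A), lattice_ideal I -> I = star (costar I)).
Proof.
split; split.
- exact: spectral_quasi_commutative.
- by apply: quasi_commutative_spectral => //; apply: finitely_generated_top sdV.
- by move=> qc I; apply: quasi_commutative_star_costar.
- exact: star_costar_quasi_commutative.
Qed.
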